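(* Let $A\in M_n(\mathbb{C})$. Then $W_{\mathbb{C}}(A)=W_{\mathbb{C}}(A^* )$ if and only if $B(A)=W_{\mathbb{C}}(A)$. Moreover, when these equivalent conditions hold, $B(A)$ is convex.
   Context: $\mathbb{H}$ denotes the Hamilton quaternions with real basis $1,i,j,k$, and $\mathbb{C}=\mathrm{span}_{\mathbb{R}}\{1,i\}\subset\mathbb{H}$. For $\mathbb{F}=\mathbb{C}$ or $\mathbb{H}$ and $A\in M_n(\mathbb{F})$, the numerical range is $W_{\mathbb{F}}(A)=\{\boldsymbol{x}^*A\boldsymbol{x}:\boldsymbol{x}\in\mathbb{F}^n,\ \boldsymbol{x}^*\boldsymbol{x}=1\}$, where $\boldsymbol{x}$ is a column vector and $^*$ denotes conjugate transpose. A complex matrix is regarded as a quaternionic matrix. The bild of $A$ is $B(A)=W_{\mathbb{H}}(A)\cap\mathbb{C}$. *)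

(* Defs.v *)
From HB Require Import structures.
From mathcomp Require Import all_boot all_order all_algebra ring.
From mathcomp Require Import boolp classical_sets reals convex.
From mathcomp Require Import complex.

Set Implicit Arguments.
Unset Strict Implicit.
Unset Printing Implicit Defensive.

Import Order.TTheory GRing.Theory Num.Theory.
Local Open Scope classical_set_scope.
Local Open Scope ring_scope.

(* Quat a b c d is a + b i + c j + d k. *)
Record quaternion (R : Type) : Type :=
  Quat { qre : R; qi : R; qj : R; qk : R }.

Section QuaternionEncoding.
Variable R : Type.

Definition quat_tuple (x : quaternion R) : R * R * R * R :=
  (qre x, qi x, qj x, qk x).

Definition tuple_quat (t : R * R * R * R) : quaternion R :=
  let: (a, b, c, d) := t in Quat a b c d.

Lemma quat_tupleK : cancel quat_tuple tuple_quat.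
Proof. by case. Qed.

End QuaternionEncoding.

HB.instance Definition _ (R : eqType) :=
  Equality.copy (quaternion R) (can_type (@quat_tupleK R)).
HB.instance Definition _ (R : choiceType) :=
  Choice.copy (quaternion R) (can_type (@quat_tupleK R)).

Section QuaternionRing.
Variable R : comNzRingType.
Implicit Types x y : quaternion R.

Definition quat_add x y : quaternion R :=
  Quat (qre x + qre y) (qi x + qi y) (qj x + qj y) (qk x + qk y).

Definition quat_opp x : quaternion R :=
  Quat (- qre x) (- qi x) (- qj x) (- qk x).

(* Hamilton's product: i^2 = j^2 = k^2 = ijk = -1. *)
Definition quat_mul x y : quaternion R :=
  let: Quat a b c d := x in
  let: Quat a' b' c' d' := y in
  Quat (a * a' - b * b' - c * c' - d * d')
       (a * b' + b * a' + c * d' - d * c')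
       (a * c' - b * d' + c * a' + d * b')
       (a * d' + b * c' - c * b' + d * a').

Definition quat_scale (r : R) x : quaternion R :=
  Quat (r * qre x) (r * qi x) (r * qj x) (r * qk x).

Lemma quat_addA : associative quat_add.
Proof. by move=> [? ? ? ?] [? ? ? ?] [? ? ? ?]; congr Quat => /=; ring. Qed.

Lemma quat_addC : commutative quat_add.
Proof. by move=> [? ? ? ?] [? ? ? ?]; congr Quat => /=; ring. Qed.

Lemma quat_add0 : left_id (Quat 0 0 0 0) quat_add.
Proof. by move=> [? ? ? ?]; congr Quat; rewrite /= add0r. Qed.

Lemma quat_addN : left_inverse (Quat 0 0 0 0) quat_opp quat_add.
Proof. by move=> [? ? ? ?]; congr Quat; rewrite /= addNr. Qed.

HB.instance Definition _ := GRing.isZmodule.Build (quaternion R)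
  quat_addA quat_addC quat_add0 quat_addN.

Lemma quat_mulA : associative quat_mul.
Proof. by move=> [? ? ? ?] [? ? ? ?] [? ? ? ?]; congr Quat => /=; ring. Qed.

Lemma quat_mul1l : left_id (Quat 1 0 0 0) quat_mul.
Proof. by move=> [? ? ? ?]; congr Quat => /=; ring. Qed.

Lemma quat_mul1r : right_id (Quat 1 0 0 0) quat_mul.
Proof. by move=> [? ? ? ?]; congr Quat => /=; ring. Qed.

Lemma quat_mulDl : left_distributive quat_mul +%R.
Proof. by move=> [? ? ? ?] [? ? ? ?] [? ? ? ?]; congr Quat => /=; ring. Qed.

Lemma quat_mulDr : right_distributive quat_mul +%R.
Proof. by move=> [? ? ? ?] [? ? ? ?] [? ? ? ?]; congr Quat => /=; ring. Qed.

Lemma quat_1neq0 : Quat 1 0 0 0 != 0 :> quaternion R.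
Proof. by apply/eqP => -[] /eqP; rewrite oner_eq0. Qed.

HB.instance Definition _ := GRing.Zmodule_isNzRing.Build (quaternion R)
  quat_mulA quat_mul1l quat_mul1r quat_mulDl quat_mulDr quat_1neq0.

Lemma quat_scaleA r s x :
  quat_scale r (quat_scale s x) = quat_scale (r * s) x.
Proof. by case: x => *; congr Quat; rewrite /= mulrA. Qed.

Lemma quat_scale1 : left_id 1 quat_scale.
Proof. by move=> [? ? ? ?]; congr Quat; rewrite /= mul1r. Qed.

Lemma quat_scaleDr : right_distributive quat_scale +%R.
Proof. by move=> r [? ? ? ?] [? ? ? ?]; congr Quat; rewrite /= mulrDr. Qed.

Lemma quat_scaleDl x :
  {morph (fun r : R => quat_scale r x) : r s / r + s >-> r + s}.
Proof. by case: x => ? ? ? ? r s; congr Quat; rewrite /= mulrDl. Qed.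

HB.instance Definition _ := GRing.Zmodule_isLmodule.Build R (quaternion R)
  quat_scaleA quat_scale1 quat_scaleDr quat_scaleDl.

Definition quat_conj x : quaternion R :=
  Quat (qre x) (- qi x) (- qj x) (- qk x).

Definition quat_of_complex (z : R[i]) : quaternion R :=
  Quat (complex.Re z) (complex.Im z) 0 0.

End QuaternionRing.

Definition adjoint_mx (F : pzRingType) (conj : F -> F) (m n : nat)
    (A : 'M[F]_(m, n)) : 'M[F]_(n, m) :=
  map_mx conj A^T.

Definition numerical_range (F : pzRingType) (conj : F -> F) (n : nat)
    (A : 'M[F]_n) : set F :=
  [set (adjoint_mx conj x *m A *m x) 0 0
     | x in [set x : 'cV[F]_n | (adjoint_mx conj x *m x) 0 0 = 1]].

Definition WC (R : realType) (n : nat) (A : 'M[R[i]]_n) : set R[i] :=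
  numerical_range (@conjc R) A.

Definition WH (R : realType) (n : nat) (A : 'M[quaternion R]_n) :
    set (quaternion R) :=
  numerical_range (@quat_conj R) A.

Definition bild (R : realType) (n : nat) (A : 'M[quaternion R]_n) :
    set (quaternion R) :=
  WH A `&` range (@quat_of_complex R).

Definition quat_mx (R : realType) (n : nat) (A : 'M[R[i]]_n) :
    'M[quaternion R]_n :=
  map_mx (@quat_of_complex R) A.

(* Main.v *)
(* For [x = u + v j] with [u], [v] complex, [x^* A x] has complex part
   [u^* A u + (v^* A v)^*], while [|x|^2 = |u|^2 + |v|^2]. So the bild contains
   [W(A)] and [W(A^* )] and lies in the convex hull of their union; when these
   two sets agree, the Toeplitz-Hausdorff theorem makes that hull [W(A)] itself.
   Conversely, [W(A^* )] is the conjugate of [W(A)], so one inclusion between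
   them gives the other. *)
Require Import Defs.
From mathcomp Require Import all_boot all_order all_algebra ring.
From mathcomp Require Import boolp classical_sets reals convex.
From mathcomp Require Import interval_inference.
From mathcomp Require Import complex.

Import Order.TTheory GRing.Theory Num.Theory.
Local Open Scope classical_set_scope.
Local Open Scope ring_scope.

(** * Sesquilinear forms over the complex numbers *)

Definition sesq {R : rcfType} {n : nat} (A : 'M[R[i]]_n) (x y : 'cV[R[i]]_n) :
    R[i] :=
  (adjoint_mx (@conjc R) x *m A *m y) 0 0.

(** Stated without an identity matrix, so that the normalisation condition in [WC] folds to it
    directly. *)
Definition sqnorm {R : rcfType} {n : nat} (x : 'cV[R[i]]_n) : R[i] :=
  (adjoint_mx (@conjc R) x *m x) 0 0.

Lemma sqnormE {R : rcfType} {n : nat} (x : 'cV[R[i]]_n) :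
  sqnorm x = sesq 1%:M x x.
Proof. by rewrite /sesq mulmx1. Qed.

Lemma sqnorm_sum {R : rcfType} {n : nat} (x : 'cV[R[i]]_n) :
  sqnorm x = \sum_i `|x i 0| ^+ 2.
Proof.
by rewrite /sqnorm mxE; apply: eq_bigr => i _; rewrite !mxE sqr_normc mulrC.
Qed.

Lemma sqnorm_ge0 {R : rcfType} {n : nat} (x : 'cV[R[i]]_n) : 0 <= sqnorm x.
Proof. by rewrite sqnorm_sum sumr_ge0 // => i _; rewrite exprn_ge0. Qed.

Lemma sqnorm_eq0 {R : rcfType} {n : nat} (x : 'cV[R[i]]_n) :
  (sqnorm x == 0) = (x == 0).
Proof.
apply/eqP/eqP => [|->]; last by rewrite /sqnorm mulmx0 mxE.
rewrite sqnorm_sum => /eqP; rewrite psumr_eq0 => [/allP x0|i _].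
  apply/colP => i; rewrite mxE.
  by move: (x0 i (mem_index_enum i)); rewrite /= sqrf_eq0 normr_eq0 => /eqP.
by rewrite exprn_ge0.
Qed.

Lemma sqnorm_real {R : rcfType} {n : nat} (x : 'cV[R[i]]_n) :
  exists2 r : R, 0 <= r & sqnorm x = r%:C%C.
Proof.
have := sqnorm_ge0 x; case: (sqnorm x) => a b.
by rewrite lecE /= => /andP[/eqP -> a0]; exists a.
Qed.

Lemma conj_eq_real {R : rcfType} (z : R[i]) :
  z^*%C = z -> z = (complex.Re z)%:C%C.
Proof.
case: z => a b [] /eqP; rewrite eq_sym -addr_eq0 -mulr2n mulrn_eq0 /= => /eqP ->.
by [].
Qed.

Lemma sesqDl {R : rcfType} {n : nat} (A : 'M[R[i]]_n) (x y z : 'cV[R[i]]_n) :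
  sesq A (x + y) z = sesq A x z + sesq A y z.
Proof. by rewrite /sesq /adjoint_mx linearD /= map_mxD !mulmxDl mxE. Qed.

Lemma sesqDr {R : rcfType} {n : nat} (A : 'M[R[i]]_n) (x y z : 'cV[R[i]]_n) :
  sesq A x (y + z) = sesq A x y + sesq A x z.
Proof. by rewrite /sesq mulmxDr mxE. Qed.

Lemma sesqZl {R : rcfType} {n : nat} (A : 'M[R[i]]_n) (x y : 'cV[R[i]]_n)
    (c : R[i]) :
  sesq A (c *: x) y = c^*%C * sesq A x y.
Proof. by rewrite /sesq /adjoint_mx linearZ /= map_mxZ -!scalemxAl mxE. Qed.

Lemma sesqZr {R : rcfType} {n : nat} (A : 'M[R[i]]_n) (x y : 'cV[R[i]]_n)
    (c : R[i]) :
  sesq A x (c *: y) = c * sesq A x y.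
Proof. by rewrite /sesq -scalemxAr mxE. Qed.

Lemma sesq_comb {R : rcfType} {n : nat} (A : 'M[R[i]]_n) (x y : 'cV[R[i]]_n)
    (s c : R[i]) :
  sesq A (s *: x + c *: y) (s *: x + c *: y) =
  s^*%C * s * sesq A x x + s^*%C * c * sesq A x y +
  c^*%C * s * sesq A y x + c^*%C * c * sesq A y y.
Proof.
rewrite sesqDl !sesqDr !sesqZl !sesqZr.
move: (sesq A x x) (sesq A x y) (sesq A y x) (sesq A y y) => a b d e.
by rewrite !mulrA !addrA.
Qed.

Lemma sesqZ {R : rcfType} {n : nat} (A : 'M[R[i]]_n) (x : 'cV[R[i]]_n)
    (c : R[i]) :
  sesq A (c *: x) (c *: x) = c^*%C * c * sesq A x x.
Proof. by rewrite sesqZl sesqZr mulrA. Qed.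

(** Serves to move two distinct values [a] and [b] of the form to 1 and 0. *)
Lemma sesq_affine {R : rcfType} {n : nat} (A : 'M[R[i]]_n)
    (x : 'cV[R[i]]_n) (k b : R[i]) :
  sesq (k *: (A - b%:M)) x x = k * (sesq A x x - b * sqnorm x).
Proof.
rewrite sqnormE /sesq -[b%:M]scalemx1 -scalemxAr mulmxBr -scalemxAl mulmxBl.
by rewrite -scalemxAr -scalemxAl !mxE.
Qed.

Lemma sesqJ {R : rcfType} {n : nat} (A : 'M[R[i]]_n) (x y : 'cV[R[i]]_n) :
  sesq (adjoint_mx (@conjc R) A) x y = (sesq A y x)^*%C.
Proof.
have eM (M : 'M[R[i]]_1) : (M 0 0)^*%C = (adjoint_mx (@conjc R) M) 0 0.
  by rewrite !mxE.
rewrite /sesq eM.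
rewrite /adjoint_mx !trmx_mul !map_mxM /= mulmxA.
congr ((_ *m _ *m _) _ _).
by apply/matrixP => i j; rewrite !mxE conjcK.
Qed.

Lemma sesq1_conj {R : rcfType} {n : nat} (x y : 'cV[R[i]]_n) :
  sesq 1%:M y x = (sesq 1%:M x y)^*%C.
Proof. by rewrite -sesqJ /adjoint_mx trmx1 map_mx1. Qed.

(** * The Toeplitz-Hausdorff theorem *)

Lemma quadratic_root {R : rcfType} (a h k : R) :
  0 < a -> 0 < k -> exists s, a * s ^+ 2 + h * s = k.
Proof.
move=> a0 k0; have d0 : 0 <= h ^+ 2 + 4 * a * k.
  by rewrite addr_ge0 ?sqr_ge0 // !mulr_ge0 // ltW.
exists ((Num.sqrt (h ^+ 2 + 4 * a * k) - h) / (2 * a)).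
have := sqr_sqrtr d0; set r := Num.sqrt _ => rE.
have an0 : a != 0 by rewrite gt_eqF.
apply/eqP; rewrite -subr_eq0.
have -> : a * ((r - h) / (2 * a)) ^+ 2 + h * ((r - h) / (2 * a)) - k =
   (r ^+ 2 - (h ^+ 2 + 4 * a * k)) / (4 * a) by field.
by rewrite rE subrr mul0r.
Qed.

(* For [z = s x + c y] the scalar [c] makes the cross term of [B] real, so that
   [z^* B z = t z^* z] is a real quadratic equation in [s] whose roots have a
   negative product; no continuity is needed. *)
Lemma sesq_intermediate {R : rcfType} {n : nat} (B : 'M[R[i]]_n)
    (x y : 'cV[R[i]]_n) (t : R) :
  sqnorm x = 1 -> sqnorm y = 1 -> sesq B x x = 1 -> sesq B y y = 0 ->
  0 < t -> t < 1 ->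
  exists2 z, z != 0 & sesq B z z = t%:C%C * sqnorm z.
Proof.
move=> Nx Ny Bx By t0 t1.
set p := sesq B x y; set q := sesq B y x.
pose w := p - q^*%C.
(* The cross term [c p + c^* q] differs from its conjugate by [c w - (c w)^*], so it is real once
   [c w] is; [c = w^*] makes [c w] a squared modulus. *)
have [c c0 cw] : exists2 c : R[i], c != 0 & (c * w)^*%C = c * w.
  have [w0|w0] := eqVneq w 0.
    by exists 1; rewrite ?oner_eq0 // w0 mulr0 conjc0.
  by exists w^*%C; rewrite ?conjc_eq0 // rmorphM /= conjcK mulrC.
have /conj_eq_real : (c * p + c^*%C * q)^*%C = c * p + c^*%C * q.
  move: cw; rewrite /w !(rmorphM, rmorphB, rmorphD) /= !conjcK => cw.
  have -> : c * p = c * (p - q^*%C) + c * q^*%C by ring.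
  by rewrite -cw; ring.
move: (complex.Re _) => h hE.
have /conj_eq_real : (c * sesq 1%:M x y + c^*%C * sesq 1%:M y x)^*%C =
    c * sesq 1%:M x y + c^*%C * sesq 1%:M y x.
  by rewrite sesq1_conj !(rmorphM, rmorphD) /= !conjcK addrC.
move: (complex.Re _) => m mE.
have /conj_eq_real : (c^*%C * c)^*%C = c^*%C * c.
  by rewrite rmorphM /= conjcK mulrC.
move: (complex.Re _) => k kE.
have k0 : 0 < k.
  by rewrite -ltcR -kE mulrC -sqr_normc exprn_gt0 // normr_gt0.
(* With [z^* B z = s^2 + s h] and [z^* z = s^2 + s m + k], this is the required equation,
   rearranged. *)
have [s sE] : exists s, (1 - t) * s ^+ 2 + (h - t * m) * s = t * k.
  by apply: quadratic_root; rewrite ?subr_gt0 // mulr_gt0.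
pose z := s%:C%C *: x + c *: y.
have Bz : sesq B z z = (s ^+ 2 + s * h)%:C%C.
  rewrite sesq_comb conjc_real Bx By -/p -/q expr2 !(rmorphD, rmorphM) /= -hE.
  by ring.
have Nz : sqnorm z = (s ^+ 2 + s * m + k)%:C%C.
  rewrite sqnormE sesq_comb conjc_real -!sqnormE Nx Ny expr2.
  by rewrite !(rmorphD, rmorphM) /= -mE -kE; ring.
exists z; last first.
  rewrite Bz Nz -rmorphM /=; congr (_%:C%C).
  have -> : t * (s ^+ 2 + s * m + k) = t * k + t * (s ^+ 2 + s * m) by ring.
  by rewrite -sE; ring.
(* If [z = 0], then [s x = - c y]; since [B] takes value 1 at [x] and 0 at [y], this forces [s = 0],
   and then [t k = 0]. *)
apply/eqP => z0.
have s0 : s = 0.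
  have : s%:C%C *: x = (- c) *: y.
    by rewrite scaleNr; apply/eqP; rewrite -addr_eq0 -/z z0.
  move=> /(congr1 (fun v => sesq B v v)).
  rewrite !sesqZ Bx By mulr1 mulr0 conjc_real.
  by rewrite -rmorphM /= => -[/eqP]; rewrite mulf_eq0 orbb => /eqP.
by move: sE => /esym/eqP; rewrite s0 expr0n /= !mulr0 addr0 mulf_eq0 !gt_eqF.
Qed.

Lemma WC_normalise {R : realType} {n : nat} (A : 'M[R[i]]_n)
    (z : 'cV[R[i]]_n) :
  z != 0 -> exists2 a, WC A a & sesq A z z = sqnorm z * a.
Proof.
move=> z0; have Nz : sqnorm z != 0 by rewrite sqnorm_eq0.
exists (sesq A z z / sqnorm z); last by rewrite mulrCA divff // mulr1.
pose c := sqrtC (sqnorm z).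
have c2 : c * c = sqnorm z by rewrite -expr2 sqrtCK.
have cJ : (c^-1)^*%C * c^-1 = (sqnorm z)^-1.
  (* The square root of a nonnegative number is nonnegative, hence real. *)
  rewrite conjc_inv; have -> : c^*%C = c.
    have : 0 <= c by rewrite sqrtC_ge0 sqnorm_ge0.
    by case: (c) => u v; rewrite lecE /= => /andP[/eqP -> _]; rewrite oppr0.
  by rewrite -invfM c2.
exists (c^-1 *: z) => /=.
  by have := sesqZ 1%:M z c^-1; rewrite -!sqnormE cJ mulVf.
by have := sesqZ A z c^-1; rewrite cJ mulrC.
Qed.

Lemma Toeplitz_Hausdorff {R : realType} {n : nat} (A : 'M[R[i]]_n) (a b : R[i])
    (t : R) :
  WC A a -> WC A b -> 0 <= t -> t <= 1 ->
  WC A (t%:C%C * a + (1 - t)%:C%C * b).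
Proof.
move=> Wa Wb; rewrite le_eqVlt => /predU1P[<- _|t0].
  by rewrite subr0 mul0r mul1r add0r.
rewrite le_eqVlt => /predU1P[->|t1].
  by rewrite subrr mul0r mul1r addr0.
have [<-|] := eqVneq a b.
  by rewrite -mulrDl -rmorphD /= addrC subrK mul1r.
rewrite -subr_eq0 => ab0.
case: Wa => x /= Nx Ax; case: Wb => y /= Ny Ay.
rewrite -/(sqnorm x) -/(sesq A x x) in Nx Ax.
rewrite -/(sqnorm y) -/(sesq A y y) in Ny Ay.
(* The normalised matrix has value 1 at [x] and 0 at [y]; the case [a = b] was set aside to allow
   the division. *)
pose B := (a - b)^-1 *: (A - b%:M).
have [||z z0 zE] := sesq_intermediate B x y t Nx Ny _ _ t0 t1.
- by rewrite sesq_affine Nx Ax mulr1 mulVf.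
- by rewrite sesq_affine Ny Ay mulr1 subrr mulr0.
have [w Ww wE] := WC_normalise A z z0.
have Nz : sqnorm z != 0 by rewrite sqnorm_eq0.
suff -> : t%:C%C * a + (1 - t)%:C%C * b = w by [].
apply: (mulfI Nz); rewrite -wE.
(* Undoing the normalisation gives [z^* A z = z^* z (t (a - b) + b)]. *)
move: zE; rewrite sesq_affine => /(congr1 ( *%R (a - b))).
rewrite mulrA divff // mul1r => /eqP; rewrite subr_eq => /eqP ->.
rewrite rmorphB /=; ring.
Qed.

(** * Quaternionic vectors as pairs of complex vectors *)

(* [z + w j], for the decomposition [H = C + C j]. *)
Definition quat_pair {R : realType} (z w : R[i]) : quaternion R :=
  Quat (complex.Re z) (complex.Im z) (complex.Re w) (complex.Im w).

Definition quat_pair_mx {R : realType} {m n : nat} (u v : 'M[R[i]]_(m, n)) :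
    'M[quaternion R]_(m, n) :=
  \matrix_(i, j) quat_pair (u i j) (v i j).

Lemma quat_pair_mx_surj {R : realType} {m n : nat}
    (x : 'M[quaternion R]_(m, n)) :
  exists u v, x = quat_pair_mx u v.
Proof.
exists (\matrix_(i, j) (qre (x i j) +i* qi (x i j))%C).
exists (\matrix_(i, j) (qj (x i j) +i* qk (x i j))%C).
by apply/matrixP => i j; rewrite !mxE; case: (x i j).
Qed.

Lemma quat_mx_pair {R : realType} {n : nat} (A : 'M[R[i]]_n) :
  quat_mx A = quat_pair_mx A 0.
Proof. by apply/matrixP => i j; rewrite !mxE. Qed.

(** The conjugate of [w j] is [- j w^* = - w j], so [v] is transposed without being conjugated. *)
Lemma adjoint_quat_pair_mx {R : realType} {m n : nat} (u v : 'M[R[i]]_(m, n)) :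
  adjoint_mx (@quat_conj R) (quat_pair_mx u v) =
  quat_pair_mx (adjoint_mx (@conjc R) u) (- v^T).
Proof.
apply/matrixP => i j; rewrite !mxE.
by case: (u j i) (v j i) => [a b] [c d].
Qed.

(** Moving [j] past a complex scalar conjugates it, and [j^2 = -1]. *)
Lemma mul_quat_pair_mx {R : realType} {m n p : nat} (u v : 'M[R[i]]_(m, n))
    (u' v' : 'M[R[i]]_(n, p)) :
  quat_pair_mx u v *m quat_pair_mx u' v' =
  quat_pair_mx (u *m u' - v *m map_mx (@conjc R) v')
               (u *m v' + v *m map_mx (@conjc R) u').
Proof.
apply/matrixP => i j; rewrite !mxE -sumrB -big_split /=.
elim/big_rec3: _ => [|l a b c _ ->]; first by [].
rewrite !mxE.
case: (u i l) (v i l) (u' l j) (v' l j) a b =>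
  [? ?] [? ?] [? ?] [? ?] [? ?] [? ?].
by congr Quat => /=; ring.
Qed.

Lemma quat_pair_form {R : realType} {n : nat} (A : 'M[R[i]]_n)
    (u v : 'cV[R[i]]_n) :
  let x := quat_pair_mx u v in
  (adjoint_mx (@quat_conj R) x *m quat_mx A *m x) 0 0 =
  quat_pair (sesq A u u + (sesq A v v)^*%C) (sesq A u v - (sesq A v u)^*%C).
Proof.
(* Moving [j] across [A] and [x] leaves the terms in [v^T] in this conjugated shape. *)
have sJ (x y : 'cV[R[i]]_n) : (sesq A x y)^*%C =
    (x^T *m map_mx (@conjc R) A *m map_mx (@conjc R) y) 0 0.
  rewrite /sesq; have eM (M : 'M[R[i]]_1) :
      (M 0 0)^*%C = (map_mx (@conjc R) M) 0 0 by rewrite mxE.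
  have xE : map_mx (@conjc R) (adjoint_mx (@conjc R) x) = x^T.
    by apply/matrixP => i j; rewrite !mxE conjcK.
  by rewrite eM map_mxM map_mxM /= xE.
rewrite /= adjoint_quat_pair_mx quat_mx_pair !mul_quat_pair_mx.
have -> : map_mx (@conjc R) (0 : 'M[R[i]]_n) = 0 by rewrite map_mx0.
rewrite !mulmx0 subr0 add0r !mulNmx opprK /quat_pair !sJ /sesq.
have mD (M N : 'M[R[i]]_1) : (M + N) 0 0 = M 0 0 + N 0 0 by rewrite mxE.
have mN (M : 'M[R[i]]_1) : (- M) 0 0 = - M 0 0 by rewrite mxE.
by rewrite [LHS]mxE !mD !mN.
Qed.

(** The form of the identity matrix is Hermitian, so the two halves of its [j] component cancel. *)
Lemma quat_pair_sqnorm {R : realType} {n : nat} (u v : 'cV[R[i]]_n) :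
  let x := quat_pair_mx u v in
  (adjoint_mx (@quat_conj R) x *m x) 0 0 =
  @quat_of_complex R (sqnorm u + sqnorm v).
Proof.
have := quat_pair_form 1%:M u v.
have -> : quat_mx (1%:M : 'M[R[i]]_n) = 1%:M.
  by apply/matrixP => i j; rewrite !mxE; case: (i == j).
rewrite /= mulmx1 => ->.
by rewrite (sesq1_conj u v) conjcK subrr -sesq1_conj -!sqnormE.
Qed.

(** * The bild compared with the complex numerical range *)

Lemma bildP {R : realType} {n : nat} (A : 'M[R[i]]_n) (q : quaternion R) :
  bild (quat_mx A) q <-> exists u v : 'cV[R[i]]_n,
    [/\ sqnorm u + sqnorm v = 1, sesq A u v = (sesq A v u)^*%C &
     q = @quat_of_complex R (sesq A u u + (sesq A v v)^*%C)].
Proof.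
split=> [[[x /= Nx <-] [w _]]|[u [v [N j ->]]]].
  have [u [v xE]] := quat_pair_mx_surj x.
  move: Nx; rewrite xE quat_pair_sqnorm quat_pair_form.
  case=> c1 c2 [_ _] /esym j1 /esym j2.
  exists u, v; split.
  - by apply/eqP; rewrite eq_complex; apply/andP; split; apply/eqP.
  - apply/eqP; rewrite -subr_eq0 eq_complex; apply/andP.
    by split; apply/eqP.
  - by rewrite /quat_pair j1 j2.
split; last by exists (sesq A u u + (sesq A v v)^*%C).
exists (quat_pair_mx u v) => /=; first by rewrite quat_pair_sqnorm N.
by rewrite quat_pair_form j subrr.
Qed.

Lemma WC_adjoint {R : realType} {n : nat} (A : 'M[R[i]]_n) (a : R[i]) :
  WC (adjoint_mx (@conjc R) A) a <-> WC A a^*%C.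
Proof.
split=> -[x Nx] /=.
  by rewrite -/(sesq _ x x) sesqJ => <-; rewrite conjcK; exists x.
move=> /(congr1 (@conjc R)); rewrite conjcK -/(sesq A x x) -sesqJ => <-.
by exists x.
Qed.

Lemma sesq0l {R : rcfType} {n : nat} (A : 'M[R[i]]_n) (x : 'cV[R[i]]_n) :
  sesq A 0 x = 0.
Proof. by rewrite /sesq /adjoint_mx trmx0 map_mx0 !mul0mx mxE. Qed.

Lemma sesq0r {R : rcfType} {n : nat} (A : 'M[R[i]]_n) (x : 'cV[R[i]]_n) :
  sesq A x 0 = 0.
Proof. by rewrite /sesq mulmx0 mxE. Qed.

Lemma WC_bild {R : realType} {n : nat} (A : 'M[R[i]]_n) (a : R[i]) :
  WC A a -> bild (quat_mx A) (@quat_of_complex R a).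
Proof.
case=> u Nu <-; apply/bildP; exists u, 0.
by rewrite (sqnormE 0) !sesq0l !sesq0r conjc0 !addr0.
Qed.

(** The quaternionic vector [v j] has the norm of [v], and its form is the conjugate of [v^* A v],
    that is [v^* A^* v]. *)
Lemma WC_adjoint_bild {R : realType} {n : nat} (A : 'M[R[i]]_n) (a : R[i]) :
  WC (adjoint_mx (@conjc R) A) a -> bild (quat_mx A) (@quat_of_complex R a).
Proof.
case=> v Nv; rewrite -/(sesq _ v v) sesqJ => <-; apply/bildP; exists 0, v.
by rewrite (sqnormE 0) !sesq0l !sesq0r conjc0 !add0r.
Qed.

(** At [z = 0] both sides vanish and any point of the range will do; this spares a case split on
    which half of a quaternionic vector is zero. *)
Lemma WC_scale {R : realType} {n : nat} (A : 'M[R[i]]_n) (z : 'cV[R[i]]_n) :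
  WC A !=set0 -> exists2 a, WC A a & sesq A z z = sqnorm z * a.
Proof.
move=> [w Ww]; have [->|z0] := eqVneq z 0; last exact: WC_normalise.
by exists w; rewrite // sqnormE !sesq0l mul0r.
Qed.

Lemma bild_sub_WC {R : realType} {n : nat} (A : 'M[R[i]]_n) :
  WC A = WC (adjoint_mx (@conjc R) A) ->
  bild (quat_mx A) `<=` @quat_of_complex R @` WC A.
Proof.
move=> WA q /bildP[u [v [N _ ->]]].
exists (sesq A u u + (sesq A v v)^*%C) => //.
(* The halves [u] and [v] cannot both vanish, as their squared norms add up to 1. *)
have W0 : WC A !=set0.
  have [u0|/(WC_normalise A)[w Ww _]] := eqVneq u 0; last by exists w.
  have [v0|/(WC_normalise A)[w Ww _]] := eqVneq v 0; last by exists w.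
  by move: N => /eqP; rewrite u0 v0 sqnormE sesq0l addr0 eq_sym oner_eq0.
rewrite -sesqJ; have [a Wa ->] := WC_scale A u W0.
have [|b] := WC_scale (adjoint_mx (@conjc R) A) v; first by rewrite -WA.
rewrite -WA => Wb ->.
(* The squared norms of [u] and [v] become the real weights [r] and [1 - r] of a convex
   combination. *)
have [r r0 Nu] := sqnorm_real u; have [r' r'0 Nv] := sqnorm_real v.
have r'E : r' = 1 - r.
  by move: N; rewrite Nu Nv -rmorphD /= => -[<-]; rewrite addrC addKr.
rewrite Nu Nv r'E; apply: Toeplitz_Hausdorff => //.
by rewrite -subr_ge0 -r'E.
Qed.

Theorem corollary3p8 (R : realType) (n : nat) (A : 'M[R[i]]_n) :
  (WC A = WC (adjoint_mx (@conjc R) A) <->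
     bild (quat_mx A) = @quat_of_complex R @` WC A) /\
  (WC A = WC (adjoint_mx (@conjc R) A) -> convex_set (bild (quat_mx A))).
Proof.
have bE : WC A = WC (adjoint_mx (@conjc R) A) ->
    bild (quat_mx A) = @quat_of_complex R @` WC A.
  move=> WA; apply/seteqP; split; first exact: bild_sub_WC.
  by move=> _ [a Wa <-]; exact: WC_bild.
split; [split=> [/bE //|BA]|move=> /bE ->].
  have sub a : WC (adjoint_mx (@conjc R) A) a -> WC A a.
    move=> /WC_adjoint_bild; rewrite BA => -[b Wb [reE imE]].
    by move: a b reE imE Wb => [? ?] [? ?] /= -> ->.
  apply/seteqP; split=> a; last exact: sub.
  (* For [a] in W(A), the conjugate of [a] is a value of the adjoint, hence of [A] by [sub];
     conjugating again puts [a] in the range of the adjoint. *)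
  by move=> Wa; apply/WC_adjoint/sub/WC_adjoint; rewrite conjcK.
move=> _ _ t /set_mem[a Wa <-] /set_mem[b Wb <-]; apply/mem_set.
exists (t%:num%:C%C * a + (1 - t%:num)%:C%C * b).
  by apply: Toeplitz_Hausdorff => //; rewrite ?ge0 ?le1.
(* The embedding of the complex numbers is real-linear, so it preserves the combination. *)
case: a b {Wa Wb} => [? ?] [? ?].
by congr Quat; rewrite /= !(mul0r, subr0, addr0, mulr0).
Qed.
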